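(* Let $r\ge2$, $\ell\ge2$. In the ring $\widetilde{\mathcal{T}}_\ell(C_r)$ the following hold for all $u\in\frac12\mathbb{Z}$: (1) $T^{(a)}_m(u+r+1+\ell)=T^{(a)}_{2\ell-m}(u)$ for $1\le a\le r-1$, $1\le m\le 2\ell-1$, and $T^{(r)}_m(u+r+1+\ell)=T^{(r)}_\ell(u)\,T^{(r)}_{\ell-m}(u)$ for $1\le m\le\ell-1$; (2) $T^{(a)}_m(u+2(r+1+\ell))=T^{(a)}_m(u)$ for all generators $T^{(a)}_m(u)$.
   Context: $\widetilde{\mathcal{T}}_\ell(C_r)$ (level $\ell$ restricted T-system of type $C_r$ with quasi-unit boundary condition) is the commutative ring with generators $T^{(a)}_m(u)^{\pm1}$ ($1\le a\le r-1$, $1\le m\le 2\ell-1$; and $a=r$, $1\le m\le\ell-1$; $u\in\frac12\mathbb{Z}$) and $T^{(r)}_\ell(u)$ ($u\in\frac12\mathbb{Z}$), with relations, for all $u\in\frac12\mathbb{Z}$: $T^{(a)}_m(u-\frac12)T^{(a)}_m(u+\frac12)=T^{(a)}_{m-1}(u)T^{(a)}_{m+1}(u)+T^{(a-1)}_m(u)T^{(a+1)}_m(u)$ ($1\le a\le r-2$, $1\le m\le2\ell-1$); $T^{(r-1)}_{2m}(u-\frac12)T^{(r-1)}_{2m}(u+\frac12)=T^{(r-1)}_{2m-1}(u)T^{(r-1)}_{2m+1}(u)+T^{(r-2)}_{2m}(u)T^{(r)}_m(u-\frac12)T^{(r)}_m(u+\frac12)$ ($1\le m\le\ell-1$); $T^{(r-1)}_{2m+1}(u-\frac12)T^{(r-1)}_{2m+1}(u+\frac12)=T^{(r-1)}_{2m}(u)T^{(r-1)}_{2m+2}(u)+T^{(r-2)}_{2m+1}(u)T^{(r)}_m(u)T^{(r)}_{m+1}(u)$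 ($0\le m\le\ell-1$); $T^{(r)}_m(u-1)T^{(r)}_m(u+1)=T^{(r)}_{m-1}(u)T^{(r)}_{m+1}(u)+T^{(r-1)}_{2m}(u)$ ($1\le m\le\ell-1$); with $T^{(0)}_m(u)=T^{(a)}_0(u)=1$ and $T^{(a)}_{2\ell}(u)=1$ ($1\le a\le r-1$) on the right sides, and $T^{(r)}_\ell(u)^2=1$, $T^{(r)}_\ell(u+1)=T^{(r)}_\ell(u)$. *)

(* Defs.v *)
From HB Require Import structures.
From mathcomp Require Import all_boot all_order all_algebra.
Set Implicit Arguments. Unset Strict Implicit. Unset Printing Implicit Defensive.
Import GRing.Theory.
Local Open Scope ring_scope.

(* Convention: u \in (1/2)Z is encoded by the integer k = 2u.  Thus
   T a m k  stands for  T^{(a)}_m(k/2);  u +- 1/2 is k +- 1, u +- 1 is k +- 2.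
   A family T in a commutative ring R "satisfies the level l restricted
   T-system of type C_r with quasi-unit boundary condition" if it satisfies
   all defining relations of \tilde T_l(C_r) (including invertibility of the
   invertible generators).  Such families are exactly the ring morphisms out
   of \tilde T_l(C_r), so an identity holds in \tilde T_l(C_r) iff it holds
   for every such family in every commutative ring. *)
Definition isRTsysC (R : comPzRingType) (r l : nat) (T : nat -> nat -> int -> R)
  : Prop :=
  (forall (a m : nat) (k : int), (1 <= a <= r - 1)%N -> (1 <= m <= 2 * l - 1)%N ->
     exists y, T a m k * y = 1) /\
  (forall (m : nat) (k : int), (1 <= m <= l - 1)%N -> exists y, T r m k * y = 1) /\
  (forall (m : nat) (k : int), T 0%N m k = 1) /\
  (forall (a : nat) (k : int), T a 0%N k = 1) /\
  (forall (a : nat) (k : int), (1 <= a <= r - 1)%N -> T a (2 * l)%N k = 1) /\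
  (forall k : int, T r l k ^+ 2 = 1) /\
  (forall k : int, T r l (k + 2) = T r l k) /\
  (forall (a m : nat) (k : int), (1 <= a <= r - 2)%N -> (1 <= m <= 2 * l - 1)%N ->
     T a m (k - 1) * T a m (k + 1)
     = T a m.-1 k * T a m.+1 k + T a.-1 m k * T a.+1 m k) /\
  (forall (m : nat) (k : int), (1 <= m <= l - 1)%N ->
     T (r - 1)%N (2 * m)%N (k - 1) * T (r - 1)%N (2 * m)%N (k + 1)
     = T (r - 1)%N (2 * m - 1)%N k * T (r - 1)%N (2 * m + 1)%N k
       + T (r - 2)%N (2 * m)%N k * T r m (k - 1) * T r m (k + 1)) /\
  (forall (m : nat) (k : int), (m <= l - 1)%N ->
     T (r - 1)%N (2 * m + 1)%N (k - 1) * T (r - 1)%N (2 * m + 1)%N (k + 1)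
     = T (r - 1)%N (2 * m)%N k * T (r - 1)%N (2 * m + 2)%N k
       + T (r - 2)%N (2 * m + 1)%N k * T r m k * T r m.+1 k) /\
  (forall (m : nat) (k : int), (1 <= m <= l - 1)%N ->
     T r m (k - 2) * T r m (k + 2)
     = T r m.-1 k * T r m.+1 k + T (r - 1)%N (2 * m)%N k).

(* Main.v *)
Require Import Defs.
From HB Require Import structures.
From mathcomp Require Import all_boot all_order all_algebra.
From mathcomp Require Import ring zify.
Set Implicit Arguments. Unset Strict Implicit. Unset Printing Implicit Defensive.
Import GRing.Theory.
Local Open Scope ring_scope.

(* Put T^(2r+2-a)_m = (-1)^m T^(a)_m, with T^(r+1)_m zero for odd m and the
   square of T^(r)_(m/2) for even m: the T-system of type C_r becomes the
   T-system (octahedron recurrence) of type A_(2r+1) at level 2l.  Condensation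
   identifies T^(a)_m with the m x m connected minors of a banded matrix A built
   from T^(a)_1, and the sign rule makes A alternating.  This settles the minors
   of row r + 1, which cannot be reached by division since half of them vanish.
   The boundary condition says that the 2l-minors are 1 and the (2l+1)-minors
   are 0, so each column of A is a combination of the 2l preceding ones; reading
   this off on the zeros of the band expresses an entry of A as a
   (2l-1)-minor half a period away, i.e. the half-periodicity for m = 1.  The
   T-system propagates it to all m. *)

(** * Units of a commutative ring *)

Definition runit (R : comPzRingType) (x : R) : Prop := exists y, x * y = 1.

Section Units.
Variable R : comPzRingType.
Implicit Types x y z : R.

Lemma runit1 : runit (1 : R).
Proof. by exists 1; rewrite mulr1. Qed.

Lemma runitM x y : runit x -> runit y -> runit (x * y).
Proof. by move=> [a xa] [b yb]; exists (a * b); rewrite mulrACA xa yb mulr1. Qed.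

Lemma runit_mulI x y z : runit x -> x * y = x * z -> y = z.
Proof.
by move=> [a xa] /(congr1 ( *%R a)); rewrite !mulrA [a * x]mulrC xa !mul1r.
Qed.

End Units.

(** * Connected minors: Cramer's rule and condensation *)

Section Minors.
Variables (R : comPzRingType) (A : nat -> nat -> R).

Definition cmx m p q : 'M[R]_m := \matrix_(i, j) A (p + i)%N (q + j)%N.
Definition cminor m p q : R := \det (cmx m p q).

(** Entry [j0] of the identity [adj(M) M v = det(M) v]. It lets minors be read off from a suitable
    vector. *)
Lemma cminor_cramer m p q (x : nat -> R) (j0 : 'I_m) :
  cminor m p q * x j0 =
  \sum_(i < m) (\sum_(j < m) A (p + i)%N (q + j)%N * x j)
                * cofactor (cmx m p q) i j0.
Proof.
pose v : 'cV[R]_m := \col_j x j.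
have := congr1 (fun B => (B *m v) j0 0) (mul_adj_mx (cmx m p q)).
rewrite mul_scalar_mx -mulmxA !mxE => <-.
apply: eq_bigr => i _; rewrite !mxE mulrC; congr (_ * _).
by apply: eq_bigr => j _; rewrite !mxE.
Qed.

(** Deleting a corner row and column of a connected block leaves a connected block, so this cofactor
    and the next two are connected minors up to sign. *)
Lemma cofactor_first m p q :
  cofactor (cmx m.+1 p q) ord0 ord0 = cminor m p.+1 q.+1.
Proof.
rewrite /cofactor expr0 mul1r; congr (\det _).
by apply/matrixP => i j; rewrite !mxE !lift0 !addnS.
Qed.

Lemma cofactor_last m p q :
  cofactor (cmx m.+1 p q) ord_max ord_max = cminor m p q.
Proof.
rewrite /cofactor -signr_odd addnn odd_double expr0 mul1r; congr (\det _).
by apply/matrixP => i j; rewrite !mxE !lift_max.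
Qed.

Lemma cofactor_corner m p q :
  cofactor (cmx m.+1 p q) ord_max ord0 = (-1) ^+ m * cminor m p q.+1.
Proof.
rewrite /cofactor addn0; congr (_ * \det _).
by apply/matrixP => i j; rewrite !mxE !lift_max !lift0 !addnS.
Qed.

Lemma cminor_solve m p q (y : nat -> R) : runit (cminor m p q) ->
  exists x : nat -> R, forall i, (i < m)%N ->
    \sum_(j < m) A (p + i)%N (q + j)%N * x j = y i.
Proof.
move=> [d dE].
have [v vE] : exists v, cmx m p q *m v = \col_(i < m) y i.
  exists (d *: (\adj (cmx m p q) *m \col_(i < m) y i)).
  by rewrite -scalemxAr mulmxA mul_mx_adj mul_scalar_mx scalerA mulrC dE scale1r.
exists (fun j => if insub j is Some j' then v j' 0 else 0) => i ltim.
have /matrixP/(_ (Ordinal ltim) 0) := vE; rewrite !mxE => <-.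
by apply: eq_bigr => j _; rewrite !mxE valK.
Qed.

Lemma cminor_inj m p q (x : nat -> R) : runit (cminor m p q) ->
  (forall i, (i < m)%N -> \sum_(j < m) A (p + i)%N (q + j)%N * x j = 0) ->
  forall j, (j < m)%N -> x j = 0.
Proof.
move=> Du x0 j ltjm; apply: (runit_mulI Du); rewrite mulr0.
rewrite (@cminor_cramer m p q x (Ordinal ltjm)) big1 // => i _.
by rewrite x0 ?mul0r.
Qed.

(** Cramer's rule at the last index; the entry 1 keeps the argument valid among zero divisors. *)
Lemma cminor_kernel m p q (x : nat -> R) : x m = 1 ->
  (forall i, (i <= m)%N -> \sum_(j < m.+1) A (p + i)%N (q + j)%N * x j = 0) ->
  cminor m.+1 p q = 0.
Proof.
move=> xm x0; have := @cminor_cramer m.+1 p q x ord_max.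
by rewrite /= xm mulr1 => ->; rewrite big1 // => i _; rewrite x0 ?mul0r // -ltnS.
Qed.

(* Desnanot-Jacobi.  All four larger minors are read off from one vector [x]
   with leading entry 1 that is annihilated by the interior rows. *)
Lemma cminor_condensation m p q : runit (cminor m p.+1 q.+1) ->
  cminor m.+2 p q * cminor m p.+1 q.+1 =
  cminor m.+1 p q * cminor m.+1 p.+1 q.+1
  - cminor m.+1 p.+1 q * cminor m.+1 p q.+1.
Proof.
move=> Cu; have [z zE] := cminor_solve (fun i => - A (p.+1 + i)%N q) Cu.
(* The trailing 0, at index [m.+1], lets the same vector serve the blocks of size [m.+1] and the one
   of size [m.+2]. *)
pose x j := if j is j'.+1 then if (j' < m)%N then z j' else 0 else 1.
pose g i := \sum_(j < m.+1) A i (q + j)%N * x j.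
have g0 i : (i < m)%N -> g (p.+1 + i)%N = 0.
  move=> ltim; rewrite /g big_ord_recl /= mulr1 addn0.
  under eq_bigr => j _ do rewrite /bump /= add1n ltn_ord addnS -addSn.
  by rewrite zE // subrr.
have E00 : cminor m.+1 p q = g p * cminor m p.+1 q.+1.
  rewrite -[LHS]mulr1 (@cminor_cramer m.+1 p q x ord0) big_ord_recl /=.
  rewrite cofactor_first addn0 [X in _ + X]big1 ?addr0 // => i _.
  by rewrite /= /bump /= add1n addnS -addSn -/(g _) g0 ?mul0r.
have E10 : cminor m.+1 p.+1 q =
    (-1) ^+ m * g (p.+1 + m)%N * cminor m p.+1 q.+1.
  rewrite -[LHS]mulr1 (@cminor_cramer m.+1 p.+1 q x ord0) big_ord_recr /=.
  rewrite cofactor_corner [X in X + _]big1 ?add0r => [|i _].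
    by rewrite -/(g _) mulrA [_ * g _]mulrC.
  by rewrite -/(g _) g0 ?mul0r.
have gS i : \sum_(j < m.+2) A i (q + j)%N * x j = g i.
  by rewrite big_ord_recr /= ltnn mulr0 addr0.
have EF : cminor m.+2 p q =
    g p * cminor m.+1 p.+1 q.+1
    + (-1) ^+ m.+1 * g (p.+1 + m)%N * cminor m.+1 p q.+1.
  rewrite -[LHS]mulr1 (@cminor_cramer m.+2 p q x ord0).
  rewrite big_ord_recl [X in _ + X]big_ord_recr /= [X in _ + (X + _)]big1 ?add0r => [|i _].
    rewrite !gS cofactor_first addn0; congr (_ + _).
    have -> : lift ord0 (@ord_max m) = ord_max by apply/val_inj.
    rewrite cofactor_corner mulrA [_ * g _]mulrC /bump /= add1n addnS -addSn.
    by rewrite addSn.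
  by rewrite gS /= /bump /= add1n addnS -addSn g0 ?mul0r.
rewrite EF E00 E10 exprS; ring.
Qed.

End Minors.

(** * Minors of alternating matrices *)

Lemma sum_alternating (R : comPzRingType) (F : nat -> nat -> R) m :
  (forall i j, F i j = - F j i) -> (forall i, F i i = 0) ->
  \sum_(i < m) \sum_(j < m) F i j = 0.
Proof.
move=> Fskew Fdiag; elim: m => [|m IHm]; first by rewrite big_ord0.
rewrite big_ord_recr /= big_ord_recr /= Fdiag addr0.
under eq_bigr => i _ do rewrite big_ord_recr /=.
rewrite big_split /= IHm add0r -big_split /= big1 // => i _.
by rewrite Fskew addNr.
Qed.

Section Skew.
Variables (R : comPzRingType) (A : nat -> nat -> R).
Hypothesis Askew : forall i j, A i j = - A j i.
Hypothesis Adiag : forall i, A i i = 0.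

Lemma cminor_skew m p q : cminor A m p q = (-1) ^+ m * cminor A m q p.
Proof.
rewrite /cminor -(det_tr (cmx A m q p)) -detZ; congr (\det _).
by apply/matrixP => i j; rewrite !mxE mulN1r -Askew.
Qed.

(* A principal block of unit determinant has even size, so this is the vanishing
   of alternating determinants of odd size, also when 2 is a zero divisor. *)
Lemma cminor_alternating_next m p :
  runit (cminor A m p p) -> cminor A m.+1 p p = 0.
Proof.
move=> Du.
have [z zE] := cminor_solve (fun i => - A (p + i)%N (p + m)%N) Du.
apply: (cminor_kernel (x := fun j => if (j < m)%N then z j else 1)).
  by rewrite ltnn.
move=> i leim; rewrite big_ord_recr /= ltnn mulr1.
under eq_bigr => j _ do rewrite ltn_ord.
have [ltim|] := ltnP i m; first by rewrite zE // addNr.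
move=> lemi; have {leim lemi} -> : i = m by lia.
rewrite Adiag addr0.
(* Skew symmetry turns the last row into the alternating form [z^T A z], whose terms cancel in pairs
   without any halving. *)
under eq_bigr => j _ do rewrite Askew -zE // mulr_suml.
apply: (sum_alternating (F := fun j k => A (p + j)%N (p + k)%N * z k * z j)).
  by move=> j k; rewrite Askew; ring.
by move=> j; rewrite Adiag !mul0r.
Qed.

End Skew.

(** * Column relations in a banded matrix and its glide symmetry *)

Section BandedTiling.
Variables (R : comPzRingType) (A : nat -> nat -> R) (s n : nat).
Let D := cminor A.
Hypothesis D1 : forall p q, (p < q + s)%N -> (q < p + s)%N -> D n.+1 p q = 1.
Hypothesis D0 : forall p q, (p < q + s)%N -> (q < p + s)%N -> D n.+2 p q = 0.
Hypothesis Aband : forall i j, (i + s < j)%N \/ (j + s < i)%N -> A i j = 0.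
Hypothesis Alow : forall j, A (j + s)%N j = 1.
Hypothesis Aup : forall i, A i (i + s)%N = -1.

Let killed p q (x : nat -> R) := forall i, (i <= n.+1)%N ->
  \sum_(j < n.+2) A (p + i)%N (q + j)%N * x j = 0.

Lemma unit_minor p q : (p < q + s)%N -> (q < p + s)%N -> runit (D n.+1 p q).
Proof. by move=> pq qp; rewrite D1 //; apply: runit1. Qed.

(** The first [n.+1] rows are solved by [D1]. By Cramer's rule the vanishing minor [D0] equals the
    value on the last row times a minor equal to 1, so that row is killed too. *)
Lemma killed_exists p q : (p < q + s)%N -> (q < p + s)%N ->
  exists x, x n.+1 = 1 /\ killed p q x.
Proof.
move=> pq qp; have Du := unit_minor pq qp.
have [z zE] := cminor_solve (fun i => - A (p + i)%N (q + n.+1)%N) Du.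
pose x j := if (j < n.+1)%N then z j else 1.
have x1 : x n.+1 = 1 by rewrite /x ltnn.
have x0 i : (i < n.+1)%N ->
    \sum_(j < n.+2) A (p + i)%N (q + j)%N * x j = 0.
  move=> lti; rewrite big_ord_recr /= x1 mulr1.
  under eq_bigr => j _ do rewrite /x ltn_ord.
  by rewrite zE // addNr.
exists x; split=> // i; rewrite leq_eqVlt => /orP[/eqP->|]; last exact: x0.
have := @cminor_cramer _ A n.+2 p q x ord_max.
rewrite -/(D _ _ _) D0 // mul0r big_ord_recr /= cofactor_last -/(D _ _ _) D1 //.
by rewrite mulr1 big1 ?add0r // => j _; rewrite /= x0 ?mul0r.
Qed.

(* The relation among the columns is determined by any [n.+1] consecutive
   rows, hence propagates from one window of rows to the next. *)
Lemma killed_step p q x : (p < q + s)%N -> (q < p + s)%N ->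
  (p.+1 < q + s)%N -> x n.+1 = 1 -> killed p q x -> killed p.+1 q x.
Proof.
move=> pq qp pq1 x1 xk.
have [y [y1 yk]] := killed_exists pq1 ltac:(lia).
have yx j : (j < n.+1)%N -> y j - x j = 0.
  apply: (cminor_inj (p := p.+1) (q := q) (x := fun j => y j - x j)).
    by apply: unit_minor => //; lia.
  move=> i lti; have := yk i ltac:(lia).
  have := xk i.+1 ltac:(lia); rewrite addnS -addSn => xki yki.
  have := congr2 (fun a b => a - b) yki xki; rewrite subrr.
  rewrite [in X in X - _]big_ord_recr [in X in _ - X]big_ord_recr /=.
  rewrite x1 y1 opprD addrACA subrr addr0 -sumrB => E0.
  rewrite -[RHS]E0.
  by apply: eq_bigr => k _; rewrite mulrBr.
move=> i lei; rewrite -[RHS](yk i lei); apply: eq_bigr => j _; congr (_ * _).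
have [/yx/eqP|] := ltnP j n.+1; first by rewrite subr_eq0 => /eqP.
have := ltn_ord j; move=> ltj lej; have -> : j = n.+1 :> nat by lia.
by rewrite x1 y1.
Qed.

(** The windows starting at rows [0] to [q + s - 1] share one relation; [q < s] makes the window at
    row 0 admissible. *)
Lemma column_relation q : (q < s)%N -> exists x, x n.+1 = 1 /\
  forall i, (i < q + s + n.+1)%N -> \sum_(j < n.+2) A i (q + j)%N * x j = 0.
Proof.
move=> ltqs; have [x [x1 xk]] := @killed_exists 0 q ltac:(lia) ltac:(lia).
have xkp p : (p < q + s)%N -> killed p q x.
  elim: p => [|p IHp] ltp //; have ltp' := ltnW ltp.
  by apply: killed_step => //; [lia | exact: IHp].
exists x; split=> // i lti; have [lei|gti] := leqP i n.+1.
  by rewrite -[i]add0n; apply: xkp => //; lia.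
have -> : i = ((i - n.+1) + n.+1)%N by lia.
by apply: xkp => //; lia.
Qed.

Variable t : nat.
Hypothesis lt_ts : (t < s)%N.

Let spanned (v : nat -> R) := exists x : nat -> R, forall i, (i < t + s + n.+1)%N ->
  v i = \sum_(j < n.+1) A i (t + j)%N * x j.

Lemma spanned_sum k (v : nat -> nat -> R) (c : nat -> R) :
  (forall j, (j < k)%N -> spanned (v j)) ->
  spanned (fun i => \sum_(j < k) v j i * c j).
Proof.
elim: k => [|k IHk] vs.
  by exists (fun=> 0) => i _; rewrite big_ord0 big1 // => j _; rewrite mulr0.
have [x xE] := IHk (fun j ltj => vs j (leqW ltj)).
have [y yE] := vs k (leqnn _).
exists (fun j => x j + y j * c k) => i lti.
rewrite big_ord_recr /= xE // yE // mulr_suml -big_split /=.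
by apply: eq_bigr => j _; ring.
Qed.

(** Beyond the first [n.+1] columns, the relation starting at column [t + m - n.+1] expresses the
    column by the preceding ones; the bound on [m] keeps that start below [s]. *)
Lemma column_spanned m : (t + m < s + n.+1)%N ->
  spanned (fun i => A i (t + m)%N).
Proof.
elim/ltn_ind: m => m IHm ltm; have [ltmn|lenm] := ltnP m n.+1.
  exists (fun j => (j == m)%:R) => i _.
  rewrite (bigD1 (Ordinal ltmn)) //= eqxx mulr1 big1 ?addr0 // => j jm.
  by rewrite -val_eqE /= in jm; rewrite (negPf jm) mulr0.
have [x [x1 xE]] := @column_relation (t + m - n.+1) ltac:(lia).
have [j ltj|y yE] := spanned_sum (k := n.+1)
    (v := fun j i => A i (t + (m - n.+1 + j))%N) (fun j => - x j).
  by apply: IHm; lia.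
exists y => i lti; rewrite -yE //.
have := xE i ltac:(lia); rewrite big_ord_recr /= x1 mulr1.
have -> : (t + m - n.+1 + n.+1 = t + m)%N by lia.
move/eqP; rewrite addrC addr_eq0 => /eqP ->; rewrite -sumrN.
by apply: eq_bigr => j _; rewrite mulrN; congr (- (A _ _ * _)); lia.
Qed.

(** Column [n + s] is a combination of columns [t] to [t + n]. Row [t + n + s] meets only the last
    of these in the band, so the entry is the last coefficient. Cramer's rule on rows [0] to [n]
    computes that coefficient: there column [n + s] has a single nonzero candidate, the -1 in row
    [n]. *)
Lemma glide_entry : A (t + n + s)%N (n + s)%N = - D n 0 t.
Proof.
have [x xE] := @column_spanned (n + s - t) ltac:(lia).
have tE : (t + (n + s - t) = n + s)%N by lia.
rewrite tE in xE.
have -> : A (t + n + s)%N (n + s)%N = x n.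
  rewrite xE; last by lia.
  rewrite big_ord_recr /= big1 => [|j _].
    by rewrite Alow mul1r add0r.
  by rewrite Aband ?mul0r //; right; have := ltn_ord j; lia.
have := @cminor_cramer _ A n.+1 0 t x ord_max.
rewrite -/(D _ _ _) D1 //; last by lia.
rewrite mul1r /= => ->; rewrite big_ord_recr /= cofactor_last.
rewrite -xE ?add0n ?Aup; last by lia.
rewrite [X in X + _]big1 ?add0r ?mulN1r // => i _.
have lti := ltn_ord i; rewrite /= -xE; last by lia.
by rewrite add0n Aband ?mul0r //; left; lia.
Qed.

End BandedTiling.

(** * Half-periodicity of a type A T-system folded at its middle row *)

Section FoldedTsystem.
Variables (R : comPzRingType) (s n : nat) (X : nat -> nat -> int -> R).
Hypothesis s_gt0 : (0 < s)%N.
Hypothesis n_odd : odd n.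
Hypothesis Xrel : forall t m k, (0 < t < s)%N -> (0 < m <= n)%N ->
  X t m (k - 1) * X t m (k + 1) =
  X t m.-1 k * X t m.+1 k + X t.+1 m k * X t.-1 m k.
Hypothesis X0odd : forall m k, odd m -> X 0%N m k = 0.
Hypothesis X0rel : forall m k, odd m -> (m <= n)%N ->
  X 0%N m.-1 k * X 0%N m.+1 k = X 1%N m k ^+ 2.
Hypothesis Xbot : forall t k, (t <= s)%N -> X t 0%N k = 1.
Hypothesis Xtop : forall t k, (t <= s)%N -> X t n.+1 k = 1.
Hypothesis Xside : forall m k, X s m k = 1.
Hypothesis Xunit : forall t m k, (t <= s)%N -> (m <= n.+1)%N ->
  (0 < t)%N || ~~ odd m -> runit (X t m k).

Section Tiling.
Variable c : int.

(** The diagonal [i - j = t] carries row [t] in steps of 2 in the time variable; the shift [c]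
    selects the parity and the origin. *)
Let band i j := if (i - j <= s)%N then X (i - j)%N 1%N (c + (i + j + 1)%:Z) else 0.
Let A i j := if (j <= i)%N then band i j else - band j i.
Let D := cminor A.

Lemma tiling_diag i : A i i = 0.
Proof. by rewrite /A /band leqnn subnn X0odd. Qed.

Lemma tiling_skew i j : A i j = - A j i.
Proof.
have [->|neij] := eqVneq i j; first by rewrite tiling_diag oppr0.
rewrite /A; have [leji|ltij] := leqP j i.
  by rewrite leqNgt ltn_neqAle eq_sym neij leji /= opprK.
by rewrite (ltnW ltij).
Qed.

Lemma tiling_band i j : (i + s < j)%N \/ (j + s < i)%N -> A i j = 0.
Proof.
have below i' j' : (j' + s < i')%N -> A i' j' = 0.
  move=> gap; rewrite /A /band ifT; last by lia.
  by rewrite ifF //; lia.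
case=> gap; last exact: below.
by rewrite tiling_skew below // oppr0.
Qed.

Lemma tiling_low j : A (j + s)%N j = 1.
Proof. by rewrite /A /band leq_addr addKn leqnn Xside. Qed.

Lemma minor_side m q : D m (q + s)%N q = 1.
Proof.
rewrite /D /cminor -det_tr det_trig.
  rewrite big1 // => i _; rewrite !mxE.
  have -> : (q + s + i = q + i + s)%N by lia.
  exact: tiling_low.
apply/is_trig_mxP => i j ltij; rewrite !mxE tiling_band //; lia.
Qed.

(** Condensation and the T-system are the same recursion in [m], and the central minor can be
    cancelled where it is a unit. *)
Lemma minorE m p q : (m <= n.+1)%N -> (q <= p)%N -> (p <= q + s)%N ->
  D m p q = X (p - q)%N m (c + (p + q + m)%:Z).
Proof.
elim/ltn_ind: m p q => m IHm p q lem leqp; rewrite leq_eqVlt => /orP[/eqP-> | ltpq].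
  by rewrite minor_side addKn Xside.
case: m IHm lem => [|[|m]] IHm lem.
- by rewrite /D /cminor det_mx00 Xbot //; lia.
- rewrite /D /cminor det_mx11 mxE !addn0 /A /band leqp ifT //; lia.
set k := c + (p + q + m.+1 + 1)%:Z.
have kE : c + (p + q + m.+2)%:Z = k by rewrite /k; lia.
have kN : k - 1 = c + (p + q + m.+1)%:Z by rewrite /k; lia.
have kP : k + 1 = c + (p.+1 + q.+1 + m.+1)%:Z by rewrite /k; lia.
have kI : k = c + (p.+1 + q.+1 + m)%:Z by rewrite /k; lia.
have kD : k = c + (p.+1 + q + m.+1)%:Z by rewrite /k; lia.
have kU : k = c + (p + q.+1 + m.+1)%:Z by rewrite /k; lia.
have Dm : D m p.+1 q.+1 = X (p - q)%N m k.
  by rewrite IHm ?subSS -?kI //; lia.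
have D00 : D m.+1 p q = X (p - q)%N m.+1 (k - 1) by rewrite IHm ?kN //; lia.
have D11 : D m.+1 p.+1 q.+1 = X (p - q)%N m.+1 (k + 1).
  by rewrite IHm ?subSS ?kP //; lia.
have D10 : D m.+1 p.+1 q = X (p - q).+1 m.+1 k.
  by rewrite IHm -?kD ?subSn //; lia.
rewrite kE; have [epq|neqpq] := eqVneq p q.
  rewrite -{}epq subnn in Dm D00 D11 D10 *.
  (* For odd [m] the central minor vanishes, so alternation replaces condensation. *)
  have [oddm|evenm] := boolP (odd m).
    rewrite X0odd //; last by rewrite /= negbK.
    apply: cminor_alternating_next; [exact: tiling_skew|exact: tiling_diag|].
    rewrite -/D D00; apply: Xunit => //; lia.
  have Du : runit (X 0%N m k) by apply: Xunit => //; lia.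
  apply: (runit_mulI Du); rewrite mulrC -Dm.
  rewrite /D cminor_condensation -/D; last by rewrite -/D Dm.
  (* This minor lies above the diagonal; reflecting it produces the square in [X0rel]. *)
  have D01 : D m.+1 p p.+1 = (-1) ^+ m.+1 * D m.+1 p.+1 p 
    by apply: cminor_skew tiling_skew _ _ _.
  rewrite D00 D11 D01 D10.
  rewrite [X in X - _]mulrC X0odd // mul0r sub0r Dm.
  have /= -> := @X0rel m.+1 k evenm ltac:(lia).
  by rewrite -signr_odd /= evenm; ring.
have Du : runit (X (p - q)%N m k) by apply: Xunit; lia.
have D01 : D m.+1 p q.+1 = X (p - q).-1 m.+1 k.
  by rewrite IHm -?kU ?subnS //; lia.
apply: (runit_mulI Du); rewrite mulrC -Dm.
rewrite /D cminor_condensation -/D; last by rewrite -/D Dm.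
rewrite D00 D11 D10 D01 Dm Xrel; [by rewrite addrK | lia | lia].
Qed.

Lemma minor_top p q : (p < q + s)%N -> (q < p + s)%N -> D n.+1 p q = 1.
Proof.
move=> pq qp; have [leqp|ltpq] := leqP q p.
  by rewrite minorE ?Xtop //; lia.
rewrite /D (cminor_skew tiling_skew) -/D minorE ?Xtop //; [|lia|lia|lia].
by rewrite mulr1 -signr_odd /= n_odd.
Qed.

(** Off the diagonal condensation gives [1 * 1 - 1 * 1]. On the diagonal the central minor has odd
    size [n] and is no unit to cancel, so alternation is used. *)
Lemma minor_above p q : (p < q + s)%N -> (q < p + s)%N -> D n.+2 p q = 0.
Proof.
wlog leqp : p q / (q <= p)%N => [IH|] pq qp.
  have [|/ltnW lepq] := leqP q p; first by move=> ?; apply: IH.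
  by rewrite /D (cminor_skew tiling_skew) -/D IH ?mulr0.
have [->|neqpq] := eqVneq p q.
  apply: cminor_alternating_next; [exact: tiling_skew|exact: tiling_diag|].
  by rewrite -/D minor_top; [exact: runit1|lia|lia].
have side u v : (v <= u)%N -> (u <= v + s)%N -> D n.+1 u v = 1.
  by move=> vu uv; rewrite minorE ?Xtop //; lia.
have Du : runit (D n p.+1 q.+1).
  by rewrite minorE; [apply: Xunit; lia|lia..].
apply: (runit_mulI Du); rewrite mulr0 mulrC.
rewrite /D cminor_condensation -/D // !side ?subrr //; lia.
Qed.

End Tiling.

Lemma glide_first t k : (0 < t < s)%N ->
  X t 1%N (k + (n.+1 + 2 * s)%:Z) = X t n k.
Proof.
move=> /andP[t_gt0 lt_ts].
(* This places the [n]-minor with corner [(t, 0)] at time [k]. Its transposition sign, [n] being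
   odd, cancels the sign in [glide_entry]. *)
pose c := k - (t + n)%:Z.
have skew := tiling_skew c.
have := glide_entry (minor_top c) (minor_above c) (tiling_band c)
  (tiling_low c) _ lt_ts.
rewrite (cminor_skew skew) minorE; [|lia..].
rewrite -signr_odd n_odd expr1 mulN1r opprK subn0 ifT; last by lia.
have -> : (t + n + s - (n + s) = t)%N by lia.
rewrite (ltnW lt_ts) => E.
have -> : k = c + (t + 0 + n)%:Z by rewrite /c; lia.
rewrite -E; last by move=> i; rewrite skew tiling_low.
by congr (X _ _ _); lia.
Qed.

(** The relation at [m.+1] determines level [m.+2] from lower levels, and the relations are
    invariant under replacing [m] by [n.+1 - m]. *)
Lemma half_period t m k : (t <= s)%N -> (m <= n.+1)%N ->
  X t m (k + (n.+1 + 2 * s)%:Z) = X t (n.+1 - m)%N k.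
Proof.
set N := (_ + _)%:Z.
elim/ltn_ind: m t k => m IHm t k lets; rewrite leq_eqVlt => /orP[/eqP->|ltmn].
  by rewrite subnn Xtop ?Xbot.
case: m IHm ltmn => [|m] IHm ltmn; first by rewrite subn0 Xtop ?Xbot.
have [->|nets] := eqVneq t s; first by rewrite !Xside.
have [->|t_neq0] := eqVneq t 0%N.
  have [oddm|evenm] := boolP (odd m.+1).
    by rewrite !X0odd //; lia.
  case: m => [|m] in IHm ltmn evenm *; first by [].
  have Du : runit (X 0%N m (k + N)) by apply: Xunit; lia.
  apply: (runit_mulI Du).
  have /= -> := @X0rel m.+1 (k + N) ltac:(lia) ltac:(lia).
  rewrite !IHm; [|lia..].
  have := @X0rel (n.+1 - m.+1)%N k ltac:(lia) ltac:(lia).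
  have -> : ((n.+1 - m.+1).-1 = n.+1 - m.+2)%N by lia.
  have -> : ((n.+1 - m.+1).+1 = n.+1 - m)%N by lia.
  by move=> <-; rewrite mulrC.
case: m => [|m] in IHm ltmn *.
  by rewrite subn1 glide_first //; lia.
have Du : runit (X t m (k + N)) by apply: Xunit; lia.
apply: (runit_mulI Du).
have /= := @Xrel t m.+1 (k + N) ltac:(lia) ltac:(lia).
set y := X t m.+2 _.
have -> : k + N - 1 = k - 1 + N by lia.
have -> : k + N + 1 = k + 1 + N by lia.
rewrite !IHm; [|lia..].
have := @Xrel t (n.+1 - m.+1)%N k ltac:(lia) ltac:(lia).
have -> : ((n.+1 - m.+1).-1 = n.+1 - m.+2)%N by lia.
have -> : ((n.+1 - m.+1).+1 = n.+1 - m)%N by lia.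
by move=> -> /addIr <-; rewrite mulrC.
Qed.

End FoldedTsystem.

(* Row [t] corresponds to the node [a = r + 1 - t]; row 1 glues neighbouring
   [T^(r)]'s, and row 0 is the middle row [r + 1] of a T-system of type A_(2r+1). *)
Definition folding (R : comPzRingType) (r : nat) (T : nat -> nat -> int -> R)
    (t m : nat) (k : int) : R :=
  match t with
  | 0 => if odd m then 0 else T r m./2 k ^+ 2
  | 1 => if odd m then T r m./2 k * T r m./2.+1 k
         else T r m./2 (k - 1) * T r m./2 (k + 1)
  | t'.+2 => T (r - t'.+1)%N m k
  end.

(** * The type C system as a folded system with [s = r + 1] and [n + 1 = 2 l] *)

Section TypeC.
Variables (R : comPzRingType) (r l : nat) (T : nat -> nat -> int -> R).
Hypothesis hr : (2 <= r)%N.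
Hypothesis hl : (2 <= l)%N.
Hypothesis HT : isRTsysC r l T.

Let X := folding r T.
Let n := (2 * l).-1.

Lemma even_or_odd m : {j | m = (2 * j)%N} + {j | m = (2 * j + 1)%N}.
Proof.
case: (boolP (odd m)) => om; [right|left]; exists m./2; lia.
Qed.

Lemma halfE j : ((2 * j)./2 = j)%N.
Proof. lia. Qed.

Lemma halfE1 j : ((2 * j + 1)./2 = j)%N.
Proof. lia. Qed.

Lemma odd2 j : odd (2 * j) = false.
Proof. lia. Qed.

Lemma odd21 j : odd (2 * j + 1) = true.
Proof. lia. Qed.

Definition parE := (halfE, halfE1, odd2, odd21).

Lemma last_unit m k : (m <= l)%N -> runit (T r m k).
Proof.
have [_ [Tu [_ [Tbot [_ [Tl _]]]]]] := HT.
move=> lem; have [->|m0] := eqVneq m 0%N; first by rewrite Tbot; apply: runit1.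
have [->|ml] := eqVneq m l; last by apply: Tu; lia.
by exists (T r l k); rewrite -expr2 Tl.
Qed.

Lemma folding_unit t m k : (t <= r.+1)%N -> (m <= n.+1)%N ->
  (0 < t)%N || ~~ odd m -> runit (X t m k).
Proof.
rewrite /n => let_ lem; case: t let_ => [|[|t]] let_ /=.
- by move=> /negbTE ->; rewrite expr2; apply: runitM; apply: last_unit; lia.
- by move=> _; case: ifP => om; apply: runitM; apply: last_unit; lia.
move=> _; have [Tu [_ [T0 [Tbot [Ttop _]]]]] := HT.
have [->|m0] := eqVneq m 0%N; first by rewrite Tbot; apply: runit1.
have [->|t0] := eqVneq (r - t.+1)%N 0%N; first by rewrite T0; apply: runit1.
have [->|ml] := eqVneq m (2 * l)%N; first by rewrite Ttop; [apply: runit1|lia].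
by apply: Tu; lia.
Qed.

Lemma folding0_even j k : X 0%N (2 * j)%N k = T r j k ^+ 2.
Proof. by rewrite /X /= !parE. Qed.

Lemma folding1_even j k : X 1%N (2 * j)%N k = T r j (k - 1) * T r j (k + 1).
Proof. by rewrite /X /= !parE. Qed.

Lemma folding1_odd j k : X 1%N (2 * j + 1)%N k = T r j k * T r j.+1 k.
Proof. by rewrite /X /= !parE. Qed.

Lemma folding_odd m k : odd m -> X 0%N m k = 0.
Proof. by rewrite /X /= => ->. Qed.

Lemma folding_gt1 t m k : X t.+2 m k = T (r - t.+1)%N m k.
Proof. by []. Qed.

(** For [m = 2 j] this is the relation at node [r] multiplied by [T r j k ^+ 2]. For odd [m] row 0
    vanishes and both sides are the same product. *)
Lemma folding_rel1 m k : (0 < m <= n)%N ->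
  X 1%N m (k - 1) * X 1%N m (k + 1) =
  X 1%N m.-1 k * X 1%N m.+1 k + X 2%N m k * X 0%N m k.
Proof.
have [_ [_ [_ [_ [_ [_ [_ [_ [_ [_ rel4]]]]]]]]]] := HT.
rewrite /n => ltm; have [[j mE]|[j mE]] := even_or_odd m.
  have rel := rel4 j k ltac:(lia).
  have -> : m.-1 = (2 * j.-1 + 1)%N by lia.
  have -> : m.+1 = (2 * j + 1)%N by lia.
  rewrite mE folding_gt1 folding0_even !folding1_even !folding1_odd.
  have -> : j.-1.+1 = j by lia.
  have -> : k - 1 - 1 = k - 2 by lia.
  have -> : k + 1 + 1 = k + 2 by lia.
  have -> : k - 1 + 1 = k by lia.
  have -> : k + 1 - 1 = k by lia.
  transitivity (T r j (k - 2) * T r j (k + 2) * T r j k ^+ 2); first by ring.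
  by rewrite rel; ring.
have -> : m.-1 = (2 * j)%N by lia.
have -> : m.+1 = (2 * j.+1)%N by lia.
rewrite mE (@folding_odd (_ + _)) ?odd21 //.
rewrite !folding1_even !folding1_odd; ring.
Qed.

Lemma folding_rel2 m k : (0 < m <= n)%N ->
  X 2%N m (k - 1) * X 2%N m (k + 1) =
  X 2%N m.-1 k * X 2%N m.+1 k + X 3%N m k * X 1%N m k.
Proof.
have [_ [_ [_ [_ [_ [_ [_ [_ [rel2 [rel3 _]]]]]]]]]] := HT.
rewrite /n => ltm; have [[j mE]|[j mE]] := even_or_odd m.
  have -> : m.-1 = (2 * j - 1)%N by lia.
  have -> : m.+1 = (2 * j + 1)%N by lia.
  by rewrite mE folding1_even !folding_gt1 rel2 ?mulrA //; lia.
have -> : m.-1 = (2 * j)%N by lia.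
have -> : m.+1 = (2 * j + 2)%N by lia.
by rewrite mE folding1_odd !folding_gt1 rel3 ?mulrA //; lia.
Qed.

Lemma folding_rel t m k : (0 < t < r.+1)%N -> (0 < m <= n)%N ->
  X t m (k - 1) * X t m (k + 1) =
  X t m.-1 k * X t m.+1 k + X t.+1 m k * X t.-1 m k.
Proof.
have [_ [_ [_ [_ [_ [_ [_ [rel1 _]]]]]]]] := HT.
case: t => [|[|[|t]]] // ltt ltm; [exact: folding_rel1|exact: folding_rel2|].
rewrite !folding_gt1 rel1; [|lia|by rewrite /n in ltm; lia].
have -> : (r - t.+2).-1 = (r - t.+3)%N by lia.
by have -> : (r - t.+2).+1 = (r - t.+1)%N by lia.
Qed.

Lemma folding0_rel m k : odd m -> (m <= n)%N ->
  X 0%N m.-1 k * X 0%N m.+1 k = X 1%N m k ^+ 2.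
Proof.
have [[j mE]|[j mE]] := even_or_odd m; first by rewrite mE odd2.
move=> _ _; have -> : m.-1 = (2 * j)%N by lia.
have -> : m.+1 = (2 * j.+1)%N by lia.
by rewrite mE !folding0_even folding1_odd; ring.
Qed.

Lemma folding_bottom t k : X t 0%N k = 1.
Proof.
have [_ [_ [_ [Tbot _]]]] := HT.
by case: t => [|[|t]]; rewrite /X /= !Tbot ?mul1r ?expr1n.
Qed.

Lemma folding_top t k : (t <= r.+1)%N -> X t n.+1 k = 1.
Proof.
have [_ [_ [T0 [_ [Ttop [Tl [Tper _]]]]]]] := HT.
have -> : n.+1 = (2 * l)%N by rewrite /n; lia.
case: t => [|[|t]] let_; rewrite /X /= ?parE ?Tl //.
  (* The two factors agree by the periodicity of [T r l], so their product is a square. *)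
  rewrite -(Tper (k - 1)); have -> : k - 1 + 2 = k + 1 by lia.
  by rewrite -expr2 Tl.
by have [->|t0] := eqVneq (r - t.+1)%N 0%N; [rewrite T0|rewrite Ttop //; lia].
Qed.

Lemma folding_side m k : X r.+1 m k = 1.
Proof.
have [_ [_ [T0 _]]] := HT.
have -> : r.+1 = r.-1.+2 by lia.
by rewrite folding_gt1; have -> : (r - r.-1.+1 = 0)%N by lia.
Qed.

Lemma folding_half_period t m k : (t <= r.+1)%N -> (m <= 2 * l)%N ->
  X t m (k + (2 * (r + 1 + l))%:Z) = X t (2 * l - m)%N k.
Proof.
move=> let_ lem.
have nE : n.+1 = (2 * l)%N by rewrite /n; lia.
have NE : (2 * (r + 1 + l) = n.+1 + 2 * r.+1)%N by lia.
rewrite NE -nE; apply: half_period => //; last by lia.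
- by rewrite /n; lia.
- exact: folding_rel.
- exact: folding_odd.
- exact: folding0_rel.
- by move=> *; apply: folding_bottom.
- exact: folding_top.
- exact: folding_side.
- exact: folding_unit.
Qed.

Lemma half_period_inner a m k : (1 <= a <= r - 1)%N -> (m <= 2 * l)%N ->
  T a m (k + (2 * (r + 1 + l))%:Z) = T a (2 * l - m)%N k.
Proof.
move=> lea lem; have := @folding_half_period (r - a - 1).+2 m k ltac:(lia) lem.
by rewrite /X /=; have -> : (r - (r - a - 1).+1 = a)%N by lia.
Qed.

(** Row 0 only controls squares. Row 1 at odd sizes controls products of neighbours, from which each
    factor follows by division, starting from [1 = T r l k ^+ 2]. *)
Lemma half_period_last m k : (m <= l)%N ->
  T r m (k + (2 * (r + 1 + l))%:Z) = T r l k * T r (l - m)%N k.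
Proof.
have [_ [_ [_ [Tbot [_ [Tl _]]]]]] := HT.
elim: m => [_|m IHm ltm]; first by rewrite Tbot subn0 -expr2 Tl.
have := @folding_half_period 1 (2 * m + 1) k ltac:(lia) ltac:(lia).
have -> : (2 * l - (2 * m + 1) = 2 * (l - m.+1) + 1)%N by lia.
rewrite !folding1_odd; have -> : (l - m.+1).+1 = (l - m)%N by lia.
move=> E; apply: runit_mulI (@last_unit m (k + (2 * (r + 1 + l))%:Z) (ltnW ltm)) _.
rewrite E.
rewrite IHm; last exact: ltnW.
transitivity (T r l k ^+ 2 * (T r (l - m.+1)%N k * T r (l - m)%N k)).
  by rewrite Tl mul1r.
by ring.
Qed.

Lemma last_top_shift k (j : nat) : T r l (k + (2 * j)%:Z) = T r l k.
Proof.
have [_ [_ [_ [_ [_ [_ [Tper _]]]]]]] := HT.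
elim: j => [|j IHj]; first by rewrite muln0 addr0.
rewrite -{}IHj -[RHS]Tper; congr (T _ _ _); lia.
Qed.

End TypeC.

Theorem theorem6p3 (r l : nat) (hr : (2 <= r)%N) (hl : (2 <= l)%N)
  (R : comPzRingType) (T : nat -> nat -> int -> R) :
  isRTsysC r l T ->
  ((forall (a m : nat) (k : int), (1 <= a <= r - 1)%N -> (1 <= m <= 2 * l - 1)%N ->
      T a m (k + (2 * (r + 1 + l))%:Z) = T a (2 * l - m)%N k) /\
   (forall (m : nat) (k : int), (1 <= m <= l - 1)%N ->
      T r m (k + (2 * (r + 1 + l))%:Z) = T r l k * T r (l - m)%N k)) /\
  ((forall (a m : nat) (k : int), (1 <= a <= r - 1)%N -> (1 <= m <= 2 * l - 1)%N ->
      T a m (k + (4 * (r + 1 + l))%:Z) = T a m k) /\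
   (forall (m : nat) (k : int), (1 <= m <= l)%N ->
      T r m (k + (4 * (r + 1 + l))%:Z) = T r m k)).
Proof.
move=> HT.
have NE k : k + (4 * (r + 1 + l))%:Z =
    k + (2 * (r + 1 + l))%:Z + (2 * (r + 1 + l))%:Z by lia.
split; split.
- by move=> a m k lea lem; apply: half_period_inner => //; lia.
- by move=> m k lem; apply: half_period_last => //; lia.
- move=> a m k lea lem; rewrite NE.
  rewrite (half_period_inner hr hl HT) //; last by lia.
  rewrite (half_period_inner hr hl HT) //; last by lia.
  by congr (T _ _ _); lia.
move=> m k lem; rewrite NE.
rewrite (half_period_last hr hl HT); last by lia.
rewrite (half_period_last hr hl HT (m := (l - m)%N)); last by lia.
(* The half-period is even in [k], so both half-period steps contribute the same factor [T r l k],
   whose square is 1. *)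
rewrite (last_top_shift hr hl HT) mulrA -expr2.
have [_ [_ [_ [_ [_ [Tl _]]]]]] := HT.
by rewrite Tl mul1r; congr (T _ _ _); lia.
Qed.
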